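(* Let $p(z)\in\mathbb{C}[z]$ be a polynomial of degree $n\ge 2$ with zeros $\lambda_1,\ldots,\lambda_n$, and let $\mu_1,\ldots,\mu_{n-1}$ be the zeros of its derivative $p'$ (zeros listed with multiplicity). Then there exists a (not necessarily unique) normal matrix $A\in M_n(\mathbb{C})$ such that $\sigma(A)=\{\lambda_j\}_{j=1}^n$ and $\sigma(A_{n-1})=\{\mu_j\}_{j=1}^{n-1}$.
   Context: For an $n\times n$ matrix $A$, $A_{n-1}$ denotes its principal $(n-1)\times(n-1)$ submatrix obtained by deleting the last row and the last column. $\sigma(\cdot)$ denotes the spectrum, i.e. the list of eigenvalues counted with algebraic multiplicity; equality of spectra is equality of multisets. *)

(* Defs.v *)
From mathcomp Require Import all_boot all_order all_algebra.
From mathcomp Require Import spectral.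
From mathcomp Require Import complex.
From mathcomp Require Import reals.

Set Implicit Arguments.
Unset Strict Implicit.
Unset Printing Implicit Defensive.

Import Order.TTheory GRing.Theory Num.Theory.
Local Open Scope ring_scope.

(* The zeros of [p], each repeated according to its multiplicity. The order   *)
(* of the list is arbitrary: such lists are to be compared with [perm_eq].    *)
Definition zeros (C : closedFieldType) (p : {poly C}) : seq C :=
  sval (closed_field_poly_normal p).

Lemma zerosP (C : closedFieldType) (p : {poly C}) :
  p = lead_coef p *: \prod_(z <- zeros p) ('X - z%:P).
Proof. exact: svalP (closed_field_poly_normal p). Qed.

Lemma count_zeros (C : closedFieldType) (p : {poly C}) (z : C) :
  p != 0 -> count_mem z (zeros p) = mup z p.
Proof.
move=> p_neq0; rewrite [in RHS](zerosP p) -mul_polyC mupMr ?mu_prod_XsubC //.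
by rewrite rootC lead_coef_eq0.
Qed.

Definition spectrum (C : closedFieldType) (n : nat) (A : 'M[C]_n) : seq C :=
  zeros (char_poly A).

(* [A] with its last row and last column deleted. *)
Definition principal_pred (C : Type) (n : nat) (A : 'M[C]_n) : 'M[C]_n.-1 :=
  mxsub (widen_ord (leq_pred n)) (widen_ord (leq_pred n)) A.

(* Main.v *)
(** If [A = U D U^*] with [D = diag lambda] and [U] unitary, then
    [char_poly A_(n-1)] is the last diagonal entry of
    [adj (X - A) = U adj (X - D) U^*], that is
    [\sum_j |U_(n,j)|^2 \prod_(k != j) (X - lambda_k)]. Choosing [U] with all
    entries of its last row of modulus [n^(-1/2)] makes this the derivative of
    [\prod_k (X - lambda_k)], divided by [n]. *)
Require Import Defs.
From mathcomp Require Import all_boot all_order all_algebra.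
From mathcomp Require Import perm spectral.
From mathcomp Require Import complex.
From mathcomp Require Import reals.

Import Order.TTheory GRing.Theory Num.Theory.
Local Open Scope ring_scope.
Local Open Scope sesquilinear_scope.

Lemma perm_zerosZ (C : closedFieldType) (c : C) (p : {poly C}) :
  c != 0 -> p != 0 -> perm_eq (zeros (c *: p)) (zeros p).
Proof.
move=> c_neq0 p_neq0; apply/allP => z _ /=.
rewrite !count_zeros ?scaler_eq0 ?negb_or ?c_neq0 //.
by rewrite -mul_polyC mupMr ?rootC.
Qed.

Lemma perm_zeros_prod_XsubC (C : closedFieldType) (s : seq C) :
  perm_eq (zeros (\prod_(z <- s) ('X - z%:P))) s.
Proof.
apply/allP => z _ /=.
by rewrite count_zeros ?monic_neq0 ?monic_prod_XsubC // mu_prod_XsubC.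
Qed.

Lemma deriv_prod (R : comNzRingType) (I : finType) (F : I -> {poly R}) :
  (\prod_i F i)^`() = \sum_i (F i)^`() * \prod_(j | j != i) F j.
Proof.
(* The induction runs over duplicate-free lists, so that the filter [j != i] drops exactly one
   factor. *)
suff H (s : seq I) : uniq s ->
    (\prod_(i <- s) F i)^`() =
      \sum_(i <- s) (F i)^`() * \prod_(j <- s | j != i) F j.
  by rewrite H ?index_enum_uniq.
elim: s => [_|i s IHs /= /andP[i_notin_s uniq_s]].
  by rewrite !big_nil derivC.
rewrite !big_cons derivM IHs // eqxx /=; congr (_ * _ + _).
  rewrite [RHS]big_seq_cond [LHS]big_seq; apply: eq_bigl => j.
  by case: eqP => [->|]; rewrite ?(negPf i_notin_s) ?andbT.
rewrite mulr_sumr big_seq [RHS]big_seq; apply: eq_bigr => j j_in_s.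
rewrite big_cons mulrCA; case: eqP => // eq_ij.
by rewrite eq_ij j_in_s in i_notin_s.
Qed.

(** The cofactor at the last diagonal position has sign [(-1) ^+ (m + m) = 1], and skipping
    [ord_max] is the same as widening the index. *)
Lemma char_poly_principal_pred (R : comNzRingType) m (A : 'M[R]_m.+1) :
  char_poly (principal_pred A) = (\adj (char_poly_mx A)) ord_max ord_max.
Proof.
rewrite mxE /cofactor -signr_odd oddD addbb mul1r /char_poly.
congr (\det _); apply/matrixP => i j; rewrite !mxE.
have E k : widen_ord (leq_pred m.+1) k = lift ord_max k.
  by apply/val_inj; rewrite [RHS]lift_max.
by rewrite !E (inj_eq lift_inj).
Qed.

(** Here [N] plays the adjugate of [M], known only through [M *m N]. Multiplying
    [\adj (P *m M *m Q)] by [(P *m M *m Q) *m (P *m N *m Q)] and associating in two ways gives both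
    sides scaled by [\det M], which cancels in an integral domain. *)
Lemma adj_similar (R : idomainType) n (P Q M N : 'M[R]_n) :
  P *m Q = 1%:M -> \det M != 0 -> M *m N = (\det M)%:M ->
  \adj (P *m M *m Q) = P *m N *m Q.
Proof.
move=> PQ det_neq0 MN.
have QP : Q *m P = 1%:M by apply: mulmx1C.
have detE : \det (P *m M *m Q) = \det M.
  by rewrite !det_mulmx mulrAC -det_mulmx PQ det1 mul1r.
have : \adj (P *m M *m Q) *m ((P *m M *m Q) *m (P *m N *m Q)) =
    \det M *: (P *m N *m Q).
  by rewrite [LHS]mulmxA mul_adj_mx detE mul_scalar_mx.
have -> : (P *m M *m Q) *m (P *m N *m Q) = (\det M)%:M.
  rewrite !mulmxA -[_ *m Q *m P]mulmxA QP mulmx1 -[_ *m M *m N]mulmxA MN.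
  by rewrite -mulmxA mul_scalar_mx -scalemxAr PQ scalemx1.
rewrite mul_mx_scalar => E; apply/matrixP => i j.
by move/matrixP/(_ i j): E; rewrite !mxE => /(mulfI det_neq0).
Qed.

Lemma normal_unitary_diag (C : numClosedFieldType) n
    (U : 'M[C]_n) (d : 'rV[C]_n) :
  U \is unitarymx -> U *m diag_mx d *m U^t* \is normalmx.
Proof.
move=> U_unitary; apply/normalmxP.
rewrite !(trmx_mul, map_mxM) /= map_trmx trmxK -map_trmx tr_diag_mx map_diag_mx.
rewrite map_mxCK map_trmx !mulmxA !(mulmxKtV _ U_unitary) //.
(* Once the inner products of [U^t*] and [U] have cancelled, normality is the commutation of two
   diagonal matrices. *)
by rewrite -[_ *m diag_mx d *m _]mulmxA -[_ *m _ *m diag_mx d]mulmxA diag_mxC.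
Qed.

Lemma char_poly_mx_unitary_diag (C : numClosedFieldType) n
    (U : 'M[C]_n) (d : 'rV[C]_n) :
  U \is unitarymx ->
  char_poly_mx (U *m diag_mx d *m U^t*) =
  map_mx polyC U *m diag_mx (\row_j ('X - (d 0 j)%:P)) *m map_mx polyC (U^t*).
Proof.
move=> /unitarymxP UU.
have -> : diag_mx (\row_j ('X - (d 0 j)%:P)) = 'X%:M - map_mx polyC (diag_mx d).
  apply/matrixP => i j; rewrite !mxE.
  by case: eqP => [->|]; rewrite ?mulr1n ?mulr0n ?subr0.
rewrite mulmxBr mulmxBl mul_mx_scalar -scalemxAl -!map_mxM UU map_mx1.
by rewrite scalemx1.
Qed.

Lemma char_poly_unitary_diag (C : numClosedFieldType) n
    (U : 'M[C]_n) (d : 'rV[C]_n) :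
  U \is unitarymx ->
  char_poly (U *m diag_mx d *m U^t*) = \prod_j ('X - (d 0 j)%:P).
Proof.
move=> U_unitary; rewrite /char_poly char_poly_mx_unitary_diag // !det_mulmx.
rewrite mulrAC -det_mulmx -map_mxM (unitarymxP U_unitary) map_mx1 det1 mul1r.
by rewrite det_diag; apply: eq_bigr => j _; rewrite mxE.
Qed.

Lemma char_poly_principal_unitary_diag (C : numClosedFieldType) m
    (U : 'M[C]_m.+1) (d : 'rV[C]_m.+1) :
  U \is unitarymx ->
  char_poly (principal_pred (U *m diag_mx d *m U^t*)) =
  \sum_j (`|U ord_max j| ^+ 2) *: \prod_(k | k != j) ('X - (d 0 k)%:P).
Proof.
move=> U_unitary.
rewrite char_poly_principal_pred char_poly_mx_unitary_diag //.
(* [N] is the adjugate of the diagonal matrix with entries ['X - (d 0 j)%:P]. *)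
pose N : 'M_m.+1 := diag_mx (\row_j \prod_(k | k != j) ('X - (d 0 k)%:P)).
rewrite (@adj_similar _ _ _ _ _ N).
- rewrite mul_mx_diag mxE; apply: eq_bigr => j _; rewrite !mxE.
  by rewrite mulrAC -polyCM mul_polyC normCK.
- by rewrite -map_mxM (unitarymxP U_unitary) map_mx1.
- rewrite det_diag; apply/prodf_neq0 => j _.
  by rewrite mxE polyXsubC_eq0.
- rewrite mulmx_diag det_diag; apply/matrixP => i j; rewrite !mxE.
  case: eqP => // _; rewrite !mulr1n [RHS](bigD1 i) //= mxE.
  by congr (_ * _); apply: eq_bigr => k _; rewrite mxE.
Qed.

(** Gram-Schmidt completes even the rank-one all-ones matrix to a unitary one, whose first row is
    proportional to the all-ones row. *)
Lemma exists_unitary_flat_last_row (C : numClosedFieldType) m :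
  exists2 U : 'M[C]_m.+1, U \is unitarymx &
    forall j, `|U ord_max j| ^+ 2 = m.+1%:R^-1.
Proof.
pose B := schmidt (const_mx 1 : 'M[C]_m.+1).
have B_unitary : B \is unitarymx by apply: schmidt_unitarymx.
(* Gram-Schmidt only rescales the first row. *)
have [c cB] : exists c, forall j, c * B ord0 j = 1.
  have := row_schmidt_sub (const_mx 1 : 'M[C]_m.+1) ord0.
  rewrite (big_pred1 ord0) => [|i]; last by rewrite leqn0.
  rewrite genmxE => /sub_rVP[c cE]; exists c => j.
  by move/rowP/(_ j): cE; rewrite !mxE.
have c_neq0 : c != 0.
  by apply: contra_eq_neq (cB ord0) => ->; rewrite mul0r eq_sym oner_eq0.
have BE j : B ord0 j = c^-1 by apply: (mulfI c_neq0); rewrite cB divff.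
(* Only the first row of [B] is known to be flat, so it is swapped into last position; permuting
   rows preserves unitarity. *)
exists (xrow ord0 ord_max B) => [|j].
  have rowE i : row i (xrow ord0 ord_max B) = row (tperm ord0 ord_max i) B.
    by apply/rowP => k; rewrite !mxE.
  apply/row_unitarymxP => i j; rewrite !rowE.
  by rewrite (row_unitarymxP B_unitary) (inj_eq perm_inj).
(* The first row has norm 1 and [m.+1] equal entries, which fixes their modulus. *)
move/unitarymxP/matrixP/(_ ord0 ord0): B_unitary.
rewrite mxE (eq_bigr (fun=> `|c^-1| ^+ 2)) => [|k _]; last first.
  by rewrite normCK !mxE BE.
rewrite sumr_const card_ord !mxE tpermR BE eqxx => normE.
have n_neq0 : m.+1%:R != 0 :> C by rewrite pnatr_eq0.
by apply: (mulfI n_neq0); rewrite mulr_natl normE divff.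
Qed.

Theorem proposition1p1 (R : realType) (n : nat) (p : {poly R[i]})
    (lambda : n.-tuple R[i]) (mu : n.-1.-tuple R[i])
    (n_ge2 : (2 <= n)%N)
    (deg_p : size p = n.+1)
    (zeros_p : perm_eq lambda (zeros p))
    (zeros_dp : perm_eq mu (zeros p^`())) :
  exists A : 'M[R[i]]_n,
    [/\ A \is normalmx,
        perm_eq (spectrum A) lambda
      & perm_eq (spectrum (principal_pred A)) mu].
Proof.
case: n => [//|m] in lambda mu n_ge2 deg_p zeros_p zeros_dp *.
have [U U_unitary U_flat] := exists_unitary_flat_last_row R[i] m.
pose d : 'rV[R[i]]_m.+1 := \row_j tnth lambda j.
have prod_d : \prod_j ('X - (d 0 j)%:P) = \prod_(z <- lambda) ('X - z%:P).
  by rewrite big_tuple; apply: eq_bigr => j _; rewrite mxE.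
exists (U *m diag_mx d *m U^t*); split.
- exact: normal_unitary_diag.
- by rewrite /spectrum char_poly_unitary_diag // prod_d perm_zeros_prod_XsubC.
have p_neq0 : p != 0 by rewrite -size_poly_eq0 deg_p.
rewrite /spectrum; set q := char_poly (principal_pred _).
have q_neq0 : q != 0 by apply: monic_neq0; apply: char_poly_monic.
(* The flat weights [m.+1%:R^-1] turn the weighted sum into the product rule for [p], up to a factor
   that is nonzero in characteristic 0 and so leaves the zeros unchanged. *)
suff dpE : p^`() = (lead_coef p * m.+1%:R) *: q.
  rewrite perm_sym (perm_trans zeros_dp) // dpE perm_zerosZ //.
  by rewrite mulf_neq0 ?lead_coef_eq0 ?pnatr_eq0.
rewrite {1}(zerosP p) derivZ -scalerA -(perm_big _ zeros_p) -prod_d.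
congr (_ *: _); rewrite deriv_prod /q char_poly_principal_unitary_diag //.
rewrite scaler_sumr; apply: eq_bigr => j _.
by rewrite derivXsubC mul1r U_flat scalerA divff ?scale1r ?pnatr_eq0.
Qed.
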